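(* Let $Q\in\mathbb{R}^{m\times m}$ be symmetric, $B\in\mathbb{R}^{n\times m}$, $b\in\mathbb{R}^n$, let $K=\{x\in\{0,1\}^m: Bx=b\}$ and $\bar K=\{x\in\mathbb{R}^m: x\ge0,\ Bx=b\}$. Let $v_{GL},v_{GGL},v_{LBB'},v_{RLT_1'},v_{RLT_1},v_{LBB^*}$ be the bounds for the binary quadratic problem $\min_{x\in K}x^{\mathrm T}Qx$ defined in the context. (a) If $x\le e$ is redundant for $\bar K$ (i.e. every $x\in\bar K$ satisfies $x\le e$), then $$v_{GL}\le v_{GGL}\le v_{LBB'}=v_{RLT_1'}=v_{RLT_1}\le v_{LBB^*}.$$ (b) If $x\le e$ is not redundant for $\bar K$, then $$v_{RLT_1'}\le v_{LBB'}\le v_{LBB^*}.$$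
   Context: Inequalities between vectors or matrices are entrywise; $e$ is the all-ones vector of length $m$, $J$ the all-ones $m\times m$ matrix, $\mathcal{S}^m$ the real symmetric $m\times m$ matrices, $\langle\cdot,\cdot\rangle$ the trace/Euclidean inner product, $\mathrm{Diag}(z)$ the diagonal matrix with diagonal $z$, $\mathrm{diag}(X)$ the vector of diagonal entries of $X$, $I_k$ the $k$-th column of the $m\times m$ identity matrix. **Linearizable matrices.** A matrix $M\in\mathbb{R}^{m\times m}$ is linearizable (for the given $K$) if there is $c\in\mathbb{R}^m$ (a linearization vector of $M$) with $x^{\mathrm T}Mx=c^{\mathrm T}x$ for all $x\in K$. Matrices $M_1,\dots,M_k$ span the set of linearizable matrices if a matrix $M$ is linearizable if and only if $M=\sum_i\alpha_iM_i$ for some $\alpha\in\mathbb{R}^k$. **$v_{GL}$ and $v_{GGL}$ (Generalized Gilmore-Lawler scheme).** For a matrix $M=[q_1,\dots,q_m]$ with columns $q_k$, let $(\bar y_k,\bar z_k)\in\mathbb{R}^n\times\mathbb{R}$ be an optimal solution of $\max\{b^{\mathrm T}y_k+z_k : B^{\mathrm T}y_k+I_kz_k\le q_k\}$ for $k=1,\dots,m$; with $\bar Y=[\bar y_1,\dots,\bar y_m]$ and $\bar z=(\bar z_1,\dots,\bar z_m)^{\mathrm T}$ put $\bar c=\bar Y^{\mathrm T}b+\bar z$ and $\bar M=B^{\mathrm T}\bar Y+\mathrm{Diag}(\bar z)$. The scheme starts with $Q_0=Q$, $c=0$. For $i=0,1,2,\dots$: compute $\bar c_i,\bar Q_i$ as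 $\bar c,\bar M$ for $M=Q_i$; replace $c$ by $c+\bar c_i$; set $Q_{i+1}=Q_i-\bar Q_i+S_{i+1}$, where $S_{i+1}$ is a skew-symmetric matrix (any choice is allowed); stop if $\bar c_i=0$. When the scheme has stopped, its output is $v_{GGL}=\min_{x\in\bar K}c^{\mathrm T}x$ for the final $c$. The Gilmore-Lawler type bound is the bound given by the first iteration of the scheme, $v_{GL}=\min_{x\in\bar K}\bar c_0^{\mathrm T}x$. **$v_{LBB'}$.** $$v_{LBB'}=\max_{Y\in\mathbb{R}^{n\times m},z\in\mathbb{R}^m,y\in\mathbb{R}^n}\{b^{\mathrm T}y : B^{\mathrm T}y\le 2Y^{\mathrm T}b+z,\ B^{\mathrm T}Y+Y^{\mathrm T}B+\mathrm{Diag}(z)\le Q\}.$$ **RLT bounds.** Let $\mathcal{F}=\{(x,X)\in\mathbb{R}^m\times\mathcal{S}^m : Bx=b,\ BX=bx^{\mathrm T},\ x=\mathrm{diag}(X),\ x\ge0,\ X\ge0\}$. Then $v_{RLT_1'}=\min\{\langle Q,X\rangle:(x,X)\in\mathcal{F}\}$ and $v_{RLT_1}=\min\{\langle Q,X\rangle:(x,X)\in\mathcal{F},\ e-x\ge0,\ J-xe^{\mathrm T}-ex^{\mathrm T}+X\ge0,\ xe^{\mathrm T}-X\ge0\}$. **$v_{LBB^*}$.** Let $M_1,\dots,M_k$ span the set of linearizable matrices, with linearization vectors $c_1,\dots,c_k$, and $C=[c_1,\dots,c_k]\in\mathbb{R}^{m\times k}$. Then $$v_{LBB^*}=\max_{Y,z,\alpha,y}\Big\{b^{\mathrm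 T}y : B^{\mathrm T}Y+Y^{\mathrm T}B+\mathrm{Diag}(z)+\sum_{i=1}^k\alpha_iM_i\le Q,\ B^{\mathrm T}y\le 2Y^{\mathrm T}b+z+C\alpha\Big\}.$$
   Formalization: As v_GL ≤ v_GGL fails for some skew-symmetric choices, v_GGL is the supremum over all stopping runs, and v_GL ≤ output is also shown for runs with all Q_i ≥ 0; (a) assumes K̄ nonempty; the first inequality of (b) assumes the RLT1' or the LBB' program is feasible. *)

(* Defs.v *)
From HB Require Import structures.
From mathcomp Require Import all_boot all_order all_algebra.
From mathcomp Require Import all_classical all_reals ereal.
Set Implicit Arguments.
Unset Strict Implicit.
Unset Printing Implicit Defensive.
Import Order.TTheory GRing.Theory Num.Theory.
Local Open Scope classical_set_scope.
Local Open Scope ring_scope.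

(* Vectors are column vectors.  Optimal values are extended reals: the maximum
   of an infeasible program is -oo, the minimum of an infeasible one is +oo. *)

Definition lemx (R : realType) (p q : nat) (A A' : 'M[R]_(p, q)) : Prop :=
  forall i j, A i j <= A' i j.

Notation "A '<=m' A'" := (lemx A A') (at level 70, no associativity).

Definition dotv (R : realType) (p : nat) (u v : 'cV[R]_p) : R :=
  \sum_i u i 0 * v i 0.

Definition dotm (R : realType) (p q : nat) (A A' : 'M[R]_(p, q)) : R :=
  \sum_i \sum_j A i j * A' i j.

Definition Diag (R : realType) (m : nat) (z : 'cV[R]_m) : 'M[R]_m :=
  diag_mx z^T.

Definition diagv (R : realType) (m : nat) (X : 'M[R]_m) : 'cV[R]_m :=
  \col_i X i i.

Definition onev (R : realType) (m : nat) : 'cV[R]_m := const_mx 1.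

Definition K (R : realType) (m n : nat) (B : 'M[R]_(n, m)) (b : 'cV[R]_n)
  : set 'cV[R]_m :=
  [set x : 'cV[R]_m | (forall i, x i 0 = 0 \/ x i 0 = 1) /\ B *m x = b].

Definition Kbar (R : realType) (m n : nat) (B : 'M[R]_(n, m)) (b : 'cV[R]_n)
  : set 'cV[R]_m :=
  [set x : 'cV[R]_m | 0 <=m x /\ B *m x = b].

Definition upper_bound_redundant (R : realType) (m n : nat)
    (B : 'M[R]_(n, m)) (b : 'cV[R]_n) : Prop :=
  forall x, Kbar B b x -> x <=m onev R m.

Definition min_Kbar (R : realType) (m n : nat) (B : 'M[R]_(n, m))
    (b : 'cV[R]_n) (c : 'cV[R]_m) : \bar R :=
  ereal_inf [set (dotv c x)%:E | x in Kbar B b].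

Definition linearization_vector (R : realType) (m n : nat) (B : 'M[R]_(n, m))
    (b : 'cV[R]_n) (M : 'M[R]_m) (c : 'cV[R]_m) : Prop :=
  forall x, K B b x -> dotv x (M *m x) = dotv c x.

Definition linearizable (R : realType) (m n : nat) (B : 'M[R]_(n, m))
    (b : 'cV[R]_n) (M : 'M[R]_m) : Prop :=
  exists c, linearization_vector B b M c.

Definition spans_linearizable (R : realType) (m n : nat) (B : 'M[R]_(n, m))
    (b : 'cV[R]_n) (k : nat) (Ms : 'I_k -> 'M[R]_m) : Prop :=
  forall M : 'M[R]_m,
    linearizable B b M <->
    exists alpha : 'I_k -> R, M = \sum_i alpha i *: Ms i.

Definition GL_col_feasible (R : realType) (m n : nat) (B : 'M[R]_(n, m))
    (q : 'cV[R]_m) (k : 'I_m) (y : 'cV[R]_n) (z : R) : Prop :=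
  B^T *m y + z *: col k 1%:M <=m q.

Definition GL_col_optimal (R : realType) (m n : nat) (B : 'M[R]_(n, m))
    (b : 'cV[R]_n) (q : 'cV[R]_m) (k : 'I_m) (y : 'cV[R]_n) (z : R) : Prop :=
  GL_col_feasible B q k y z /\
  forall y' z', GL_col_feasible B q k y' z' -> dotv b y' + z' <= dotv b y + z.

Definition GL_optimal (R : realType) (m n : nat) (B : 'M[R]_(n, m))
    (b : 'cV[R]_n) (M : 'M[R]_m) (Y : 'M[R]_(n, m)) (z : 'cV[R]_m) : Prop :=
  forall k, GL_col_optimal B b (col k M) k (col k Y) (z k 0).

Definition GL_c (R : realType) (m n : nat) (b : 'cV[R]_n)
    (Y : 'M[R]_(n, m)) (z : 'cV[R]_m) : 'cV[R]_m :=
  Y^T *m b + z.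

Definition GL_M (R : realType) (m n : nat) (B : 'M[R]_(n, m))
    (Y : 'M[R]_(n, m)) (z : 'cV[R]_m) : 'M[R]_m :=
  B^T *m Y + Diag z.

Definition vGL (R : realType) (m n : nat) (B : 'M[R]_(n, m)) (b : 'cV[R]_n)
    (Y : 'M[R]_(n, m)) (z : 'cV[R]_m) : \bar R :=
  min_Kbar B b (GL_c b Y z).

(* The matrix Q_i of a run of the scheme in which step i uses the optimal
   solution (Y i, z i) and S i is the skew-symmetric matrix added in forming
   Q_i; S 0 is not used. *)
Fixpoint GGL_Q (R : realType) (m n : nat) (B : 'M[R]_(n, m)) (Q : 'M[R]_m)
    (Y : nat -> 'M[R]_(n, m)) (z : nat -> 'cV[R]_m) (S : nat -> 'M[R]_m)
    (i : nat) : 'M[R]_m :=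
  if i is i'.+1 then
    GGL_Q B Q Y z S i' - GL_M B (Y i') (z i') + S i'.+1
  else Q.

(* A run that stops at step N.  Only the values of Y and z at 0, ..., N and of
   S at 1, ..., N matter. *)
Definition GGL_run (R : realType) (m n : nat) (B : 'M[R]_(n, m))
    (b : 'cV[R]_n) (Q : 'M[R]_m) (Y : nat -> 'M[R]_(n, m))
    (z : nat -> 'cV[R]_m) (S : nat -> 'M[R]_m) (N : nat) : Prop :=
  [/\ forall i, (i <= N)%N -> GL_optimal B b (GGL_Q B Q Y z S i) (Y i) (z i),
      forall i, (0 < i <= N)%N -> (S i)^T = - S i,
      forall i, (i < N)%N -> GL_c b (Y i) (z i) <> 0
    & GL_c b (Y N) (z N) = 0].

Definition GGL_output (R : realType) (m n : nat) (B : 'M[R]_(n, m))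
    (b : 'cV[R]_n) (Y : nat -> 'M[R]_(n, m)) (z : nat -> 'cV[R]_m)
    (N : nat) : \bar R :=
  min_Kbar B b (\sum_(i < N.+1) GL_c b (Y i) (z i)).

(* The output depends on the choices made in the run, so the bound is the best
   output over all runs that stop. *)
Definition vGGL (R : realType) (m n : nat) (B : 'M[R]_(n, m)) (b : 'cV[R]_n)
    (Q : 'M[R]_m) : \bar R :=
  ereal_sup [set v | exists Y z S N,
    GGL_run B b Q Y z S N /\ v = GGL_output B b Y z N].

Definition LBB'_feasible (R : realType) (m n : nat) (B : 'M[R]_(n, m))
    (b : 'cV[R]_n) (Q : 'M[R]_m) (Y : 'M[R]_(n, m)) (z : 'cV[R]_m)
    (y : 'cV[R]_n) : Prop :=
  B^T *m y <=m 2 *: (Y^T *m b) + z /\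
  B^T *m Y + Y^T *m B + Diag z <=m Q.

Definition vLBB' (R : realType) (m n : nat) (B : 'M[R]_(n, m)) (b : 'cV[R]_n)
    (Q : 'M[R]_m) : \bar R :=
  ereal_sup [set v | exists Y z y,
    LBB'_feasible B b Q Y z y /\ v = (dotv b y)%:E].

Definition RLT1'_feasible (R : realType) (m n : nat) (B : 'M[R]_(n, m))
    (b : 'cV[R]_n) (x : 'cV[R]_m) (X : 'M[R]_m) : Prop :=
  X^T = X /\
  [/\ B *m x = b, B *m X = b *m x^T, x = diagv X, 0 <=m x & 0 <=m X].

Definition RLT1_feasible (R : realType) (m n : nat) (B : 'M[R]_(n, m))
    (b : 'cV[R]_n) (x : 'cV[R]_m) (X : 'M[R]_m) : Prop :=
  RLT1'_feasible B b x X /\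
  [/\ 0 <=m onev R m - x,
      0 <=m const_mx 1 - x *m (onev R m)^T - onev R m *m x^T + X
    & 0 <=m x *m (onev R m)^T - X].

Definition vRLT1' (R : realType) (m n : nat) (B : 'M[R]_(n, m)) (b : 'cV[R]_n)
    (Q : 'M[R]_m) : \bar R :=
  ereal_inf [set v | exists x X,
    RLT1'_feasible B b x X /\ v = (dotm Q X)%:E].

Definition vRLT1 (R : realType) (m n : nat) (B : 'M[R]_(n, m)) (b : 'cV[R]_n)
    (Q : 'M[R]_m) : \bar R :=
  ereal_inf [set v | exists x X,
    RLT1_feasible B b x X /\ v = (dotm Q X)%:E].

Definition LBBstar_feasible (R : realType) (m n : nat) (B : 'M[R]_(n, m))
    (b : 'cV[R]_n) (Q : 'M[R]_m) (k : nat) (Ms : 'I_k -> 'M[R]_m)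
    (cs : 'I_k -> 'cV[R]_m) (Y : 'M[R]_(n, m)) (z : 'cV[R]_m)
    (alpha : 'cV[R]_k) (y : 'cV[R]_n) : Prop :=
  B^T *m Y + Y^T *m B + Diag z + \sum_i alpha i 0 *: Ms i <=m Q /\
  B^T *m y <=m
    2 *: (Y^T *m b) + z + (\matrix_(i, j) cs j i 0) *m alpha.

Definition vLBBstar (R : realType) (m n : nat) (B : 'M[R]_(n, m))
    (b : 'cV[R]_n) (Q : 'M[R]_m) (k : nat) (Ms : 'I_k -> 'M[R]_m)
    (cs : 'I_k -> 'cV[R]_m) : \bar R :=
  ereal_sup [set v | exists Y z alpha y,
    LBBstar_feasible B b Q Ms cs Y z alpha y /\ v = (dotv b y)%:E].

(* Main.v *)
(* Everything rests on linear programming duality, derived from Farkas' lemma.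
   The program defining [vLBB'] is the dual of the one defining [vRLT1'], and a
   bounded nonempty [Kbar] makes it feasible.  If [x <= e] holds on [Kbar], then,
   for [(x, X)] feasible for RLT1', the columns [X_j] and [x - X_j] lie in [Kbar]
   scaled by [x_j] and [1 - x_j], which gives the remaining inequalities of RLT1.
   Summing the solutions [(Y_i, z_i)] of a run of the scheme and symmetrizing
   gives a feasible point of LBB' with the final [c] as the right-hand side, and
   the output of the run is the supremum of [b^T y] by duality over [Kbar].  Without a
   skew-symmetric term, the scheme stops right after its first iteration, so
   [vGL] is itself the output of a run. *)
Require Import Defs.
From HB Require Import structures.
From mathcomp Require Import all_boot all_order all_algebra.
From mathcomp Require Import all_classical all_reals ereal.
From mathcomp Require Import ring lra.
Set Implicit Arguments.
Unset Strict Implicit.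
Unset Printing Implicit Defensive.
Import Order.TTheory GRing.Theory Num.Theory.
Local Open Scope classical_set_scope.
Local Open Scope ring_scope.

(** * Linear functionals and Farkas' lemma *)

Section ScalarFunctions.
Context (R : realFieldType) (V : lmodType R) (f : V -> R).
Hypothesis lin_f : scalar f.

Lemma scalar_fun0 : f 0 = 0.
Proof. by have := lin_f (-1) 0 0; rewrite scaler0 addr0; lra. Qed.

Lemma scalar_funZ c v : f (c *: v) = c * f v.
Proof. by have := lin_f c v 0; rewrite !addr0 scalar_fun0 addr0. Qed.

Lemma scalar_funB c v w : f (v - c *: w) = f v - c * f w.
Proof. by rewrite -scaleNr addrC lin_f; ring. Qed.

End ScalarFunctions.

(* Induction on the number of functionals [a i] (Bartl's proof): if dropping
   [a i] breaks the implication, a witness [v0], scaled to [a i v0 = 1], allows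
   projecting every functional along [v0] onto the kernel of [a i]. *)
Lemma farkas_seq (R : realFieldType) (V : lmodType R) (I : eqType)
    (s : seq I) (a : I -> V -> R) (g : V -> R) :
  uniq s -> (forall i, scalar (a i)) -> scalar g ->
  (forall v, (forall i, i \in s -> a i v <= 0) -> g v <= 0) ->
  exists2 u : I -> R, forall i, 0 <= u i &
    forall v, g v = \sum_(i <- s) u i * a i v.
Proof.
elim: s a g => [|i s IHs] a g.
  move=> _ _ lin_g g_le0; exists (fun=> 0) => // v; rewrite big_nil.
  apply/eqP; rewrite eq_le g_le0 //=.
  have : g (-1 *: v) <= 0 by exact: g_le0.
  by rewrite scalar_funZ //; lra.
case/andP=> iNs uniq_s lin_a lin_g gP.
have extend (u : I -> R) t v :
    \sum_(j <- i :: s) (if j == i then t else u j) * a j v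
    = t * a i v + \sum_(j <- s) u j * a j v.
  rewrite big_cons eqxx; congr (_ + _); apply: eq_big_seq => j js.
  by case: eqP => // ji; rewrite -ji js in iNs.
have [gs|] := pselect (forall v, (forall j, j \in s -> a j v <= 0) -> g v <= 0).
  have [u u_ge0 uE] := IHs _ _ uniq_s lin_a lin_g gs.
  exists (fun j => if j == i then 0 else u j) => [j|v]; first by case: ifP.
  by rewrite extend mul0r add0r.
move=> /existsNP[v1 /not_implyP[av1 /negP]]; rewrite -ltNge => gv1.
have aiv1 : 0 < a i v1.
  rewrite ltNge; apply/negP => aiv1; move: gv1; rewrite ltNge => /negP; apply.
  by apply: gP => j; rewrite inE => /predU1P[->|/av1].
pose v0 := (a i v1)^-1 *: v1.
have av0E j : a j v0 = (a i v1)^-1 * a j v1 by rewrite scalar_funZ.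
have gv0 : 0 < g v0 by rewrite scalar_funZ // mulr_gt0 // invr_gt0.
have aiv0 : a i v0 = 1 by rewrite av0E mulVf // gt_eqF.
have av0 j : j \in s -> a j v0 <= 0.
  by move=> js; rewrite av0E mulr_ge0_le0 ?av1 // invr_ge0 ltW.
have [||v av_le0|u u_ge0 uE] := IHs (fun j v => a j v - a j v0 * a i v)
    (fun v => g v - g v0 * a i v) uniq_s.
- by move=> j c v w; rewrite !lin_a /=; ring.
- by move=> c v w; rewrite lin_g lin_a /=; ring.
- have := gP (v - a i v *: v0); rewrite scalar_funB // mulrC; apply=> j.
  rewrite scalar_funB // inE => /predU1P[->|/av_le0]; first by rewrite aiv0 mulr1 subrr.
  by rewrite mulrC.
exists (fun j => if j == i then g v0 - \sum_(j <- s) u j * a j v0 else u j).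
  move=> j; case: ifP => // _; rewrite subr_ge0 (le_trans _ (ltW gv0)) //.
  rewrite big_seq; apply: sumr_le0 => l ls.
  by rewrite mulr_ge0_le0 ?av0.
move=> v; rewrite extend mulrBl mulr_suml.
have -> : g v = g v0 * a i v + (g v - g v0 * a i v) by ring.
rewrite uE -addrA; congr (_ + _); rewrite addrC -sumrB.
by apply: eq_bigr => j _; ring.
Qed.

Lemma farkas (R : realFieldType) (V : lmodType R) (I : finType)
    (a : I -> V -> R) (g : V -> R) :
  (forall i, scalar (a i)) -> scalar g ->
  (forall v, (forall i, a i v <= 0) -> g v <= 0) ->
  exists2 u : I -> R, forall i, 0 <= u i &
    forall v, g v = \sum_i u i * a i v.
Proof.
move=> lin_a lin_g gP.
apply: (farkas_seq (index_enum_uniq I) lin_a lin_g) => v av.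
by apply: gP => i; apply: av; rewrite mem_index_enum.
Qed.

(** * Linear programming duality *)

Section LPDuality.
Context (R : realType) (V : lmodType R) (I : finType).
Variables (a : I -> V -> R) (g : V -> R) (d : I -> R).
Hypotheses (lin_a : forall i, scalar (a i)) (lin_g : scalar g).

Definition lp_feasible (v : V) : Prop := forall i, a i v <= d i.

(** The primal variable [v] is free in sign, so the dual constraint is an equality of
    functionals. *)
Definition lp_dual_feasible (u : I -> R) : Prop :=
  (forall i, 0 <= u i) /\ forall v, g v = \sum_i u i * a i v.

(* Homogenization: the constraint [o = None] says that the scalar coordinate is
   nonnegative. *)
Definition homog (o : option I) (p : V * R^o) : R :=
  if o is Some i then a i p.1 - d i * p.2 else - p.2.

Lemma homog_scalar o : scalar (homog o).
Proof.
case: o => [i|] c [v s] [w t] /=; last by rewrite /GRing.scale /=; ring.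
by rewrite lin_a /GRing.scale /=; ring.
Qed.

Lemma homog_feasible v s :
  (forall o, homog o (v, s) <= 0) -> 0 < s -> lp_feasible (s^-1 *: v).
Proof.
move=> hv s0 i; rewrite scalar_funZ // ler_pdivrMl // mulrC -subr_le0; exact: hv (Some i).
Qed.

Lemma sum_homog (u : option I -> R) v s :
  \sum_o u o * homog o (v, s) = - u None * s +
    (\sum_i u (Some i) * a i v - s * \sum_i u (Some i) * d i).
Proof.
rewrite (bigD1 None) //= (reindex_omap Some id) => [|[]//] /=.
rewrite mulr_sumr -sumrB mulrN mulNr; congr (_ + _).
rewrite (eq_bigl xpredT) => [|i]; last by rewrite eqxx.
by apply: eq_bigr => i _; ring.
Qed.

(** Farkas' lemma is applied to the homogenized constraints and [g v - t s]. For [s > 0] the pair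
    rescales to a feasible point; for [s = 0] the vector [v] is a recession direction, along which
    [g] cannot grow from [v0] without exceeding [t]. *)
Lemma affine_farkas v0 t :
  lp_feasible v0 -> (forall v, lp_feasible v -> g v <= t) ->
  exists2 u, lp_dual_feasible u & \sum_i u i * d i <= t.
Proof.
move=> v0P gt.
have [||u u_ge0 uE] := farkas (g := fun p : V * R^o => g p.1 - t * p.2) homog_scalar.
- by move=> c [v s] [w r] /=; rewrite lin_g /GRing.scale /=; ring.
- move=> [v s] hv /=; have := hv None; rewrite /= oppr_le0 le_eqVlt.
  case/predU1P => [s0|s0].
    rewrite -s0 mulr0 subr0 leNgt; apply/negP => gv_gt0.
    (* The step length is chosen so that [g] takes the value [t + g v > t] at the new point. *)
    suff /gt : lp_feasible (((t - g v0) / g v + 1) *: v + v0).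
      by rewrite lin_g [_ * g v]mulrDl divfK ?gt_eqF //; lra.
    move=> i; rewrite lin_a; have := hv (Some i); rewrite /= -s0 mulr0 subr0 => av.
    rewrite -[leRHS]add0r lerD ?v0P // mulr_ge0_le0 // addr_ge0 //.
    by rewrite divr_ge0 ?(ltW gv_gt0) // subr_ge0 gt.
  have := gt _ (homog_feasible hv s0).
  by rewrite scalar_funZ // ler_pdivrMl // mulrC -subr_le0.
have uE' v s := etrans (uE (v, s)) (sum_homog u v s).
(* Evaluating the identity at [(v, 0)] gives dual feasibility, and at [(0, 1)] the bound, with
   [u None] as the slack. *)
exists (fun i => u (Some i)).
  by split=> // v; have := uE' v 0; rewrite /= !(mulr0, mul0r) subr0 add0r subr0.
have := uE' 0 1; rewrite /= scalar_fun0 // big1; last first.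
  by move=> i _; rewrite scalar_fun0 // mulr0.
by have := u_ge0 None; lra.
Qed.

(** Infeasibility means that the homogenized constraints force [s <= 0], so Farkas' lemma applies to
    the functional [s]. *)
Lemma infeasible_farkas :
  ~ (exists v, lp_feasible v) ->
  exists u : I -> R, [/\ forall i, 0 <= u i,
    forall v, \sum_i u i * a i v = 0 & \sum_i u i * d i < 0].
Proof.
move=> infeas.
have [||u u_ge0 uE] := farkas (g := fun p : V * R^o => p.2 : R) homog_scalar.
- by move=> c [v s] [w r].
- move=> [v s] hv /=; rewrite leNgt; apply/negP => s0.
  by apply: infeas; exists (s^-1 *: v); exact: homog_feasible.
have uE' v s := etrans (uE (v, s)) (sum_homog u v s).
exists (fun i => u (Some i)); split => //.
  by move=> v; have := uE' v 0; rewrite /= !(mulr0, mul0r) subr0 add0r.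
have := uE' 0 1; rewrite /= big1; last first.
  by move=> i _; rewrite scalar_fun0 // mulr0.
by have := u_ge0 None; lra.
Qed.

(** If both programs were infeasible, the inequality would read [+oo <= -oo]; the hypothesis
    excludes this case. *)
Theorem lp_strong_duality :
  (exists u, lp_dual_feasible u) \/ (exists v, lp_feasible v) ->
  (ereal_inf [set (\sum_i u i * d i)%:E | u in lp_dual_feasible]
   <= ereal_sup [set (g v)%:E | v in lp_feasible])%E.
Proof.
move=> feas; have [[v0 v0P]|infeas] := pselect (exists v, lp_feasible v).
  have gle v : lp_feasible v ->
      ((g v)%:E <= ereal_sup [set (g v)%:E | v in lp_feasible])%E.
    by move=> vP; apply: ereal_sup_ubound; exists v.
  move: gle; case: ereal_sup => [t||] gle; last 2 first.
  - by rewrite leey.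
  - by have := gle _ v0P.
  have [|u uP ut] := affine_farkas v0P (t := t).
    by move=> v vP; rewrite -lee_fin gle.
  by apply: le_trans (_ : (\sum_i u i * d i)%:E <= _)%E;
    [apply: ereal_inf_lbound; exists u|rewrite lee_fin].
case: feas => [[u0 [u0_ge0 u0E]]|//].
have [u [u_ge0 uE ud]] := infeasible_farkas infeas.
suff -> : ereal_inf [set (\sum_i u i * d i)%:E | u in lp_dual_feasible] = -oo%E.
  by rewrite leNye.
apply: eq_ninfty => t.
(* The dual is unbounded along the certificate [u]: moving from [u0] by [c] times [u] brings the
   dual value down to at most [t]. *)
pose c := Num.max 0 ((t - \sum_i u0 i * d i) / \sum_i u i * d i).
have c_ge0 : 0 <= c by rewrite le_max lexx.
apply: le_trans (_ : (\sum_i (u0 i + c * u i) * d i)%:E <= _)%E.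
  apply: ereal_inf_lbound; exists (fun i => u0 i + c * u i) => //; split.
    by move=> i; rewrite addr_ge0 // mulr_ge0.
  move=> v; under eq_bigr do rewrite mulrDl -mulrA.
  by rewrite big_split /= -mulr_sumr uE mulr0 addr0; exact: u0E.
have -> : \sum_i (u0 i + c * u i) * d i
    = \sum_i u0 i * d i + c * \sum_i u i * d i.
  by under eq_bigr do rewrite mulrDl -mulrA; rewrite big_split /= -mulr_sumr.
by rewrite lee_fin -lerBrDl -ler_ndivrMr // le_max lexx orbT.
Qed.

End LPDuality.

(** * Inner products and the Lagrangian of LBB' *)

Section Pairings.
Context (R : realType).

Lemma dotmE p q (A A' : 'M[R]_(p, q)) : dotm A A' = \tr (A^T *m A').
Proof.
rewrite /dotm /mxtrace exchange_big; apply: eq_bigr => j _.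
by rewrite mxE; apply: eq_bigr => i _; rewrite mxE.
Qed.

Lemma dotvE p (u v : 'cV[R]_p) : dotv u v = \tr (u^T *m v).
Proof. by rewrite -dotmE; apply: eq_bigr => i _; rewrite big_ord1. Qed.

Lemma dotvDl p (u u' v : 'cV[R]_p) : dotv (u + u') v = dotv u v + dotv u' v.
Proof. by rewrite !dotvE linearD mulmxDl linearD. Qed.

Lemma dotvDr p (u v v' : 'cV[R]_p) : dotv u (v + v') = dotv u v + dotv u v'.
Proof. by rewrite !dotvE mulmxDr linearD. Qed.

Lemma dotvZr p c (u v : 'cV[R]_p) : dotv u (c *: v) = c * dotv u v.
Proof. by rewrite !dotvE -scalemxAr linearZ. Qed.

Lemma dotmDr p q (A C C' : 'M[R]_(p, q)) :
  dotm A (C + C') = dotm A C + dotm A C'.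
Proof. by rewrite !dotmE mulmxDr linearD. Qed.

Lemma dotmDl p q (A A' C : 'M[R]_(p, q)) :
  dotm (A + A') C = dotm A C + dotm A' C.
Proof. by rewrite !dotmE linearD mulmxDl linearD. Qed.

Lemma dotmZl p q c (A C : 'M[R]_(p, q)) : dotm (c *: A) C = c * dotm A C.
Proof. by rewrite !dotmE linearZ -scalemxAl linearZ. Qed.

Lemma dotm_tr p q (A C : 'M[R]_(p, q)) : dotm A^T C^T = dotm A C.
Proof. by rewrite /dotm exchange_big; do 2!apply: eq_bigr => ? _; rewrite !mxE. Qed.

Lemma dotm_delta p q (A : 'M[R]_(p, q)) i j : dotm A (delta_mx i j) = A i j.
Proof.
rewrite /dotm (bigD1 i) //= (bigD1 j) //= mxE !eqxx mulr1 -addrA.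
rewrite big1 ?add0r => [|k kj]; last by rewrite mxE (negPf kj) andbF mulr0.
rewrite big1 ?addr0 // => k ki; apply: big1 => l _.
by rewrite mxE (negPf ki) mulr0.
Qed.

Lemma dotv_delta p (u : 'cV[R]_p) i : dotv u (delta_mx i 0) = u i 0.
Proof. by rewrite dotvE -dotmE dotm_delta. Qed.

Lemma le_dotv p (u v w : 'cV[R]_p) : 0 <=m u -> v <=m w -> dotv u v <= dotv u w.
Proof.
move=> u_ge0 vw; apply: ler_sum => i _; apply: ler_wpM2l => //.
by have := u_ge0 i 0; rewrite mxE.
Qed.

Lemma le_dotm p q (A C D : 'M[R]_(p, q)) :
  0 <=m A -> C <=m D -> dotm A C <= dotm A D.
Proof.
move=> A_ge0 CD; apply: ler_sum => i _; apply: ler_sum => j _; apply: ler_wpM2l => //.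
by have := A_ge0 i j; rewrite mxE.
Qed.

Lemma dotvC p (u v : 'cV[R]_p) : dotv u v = dotv v u.
Proof. by apply: eq_bigr => i _; rewrite mulrC. Qed.

Lemma dotmC p q (A C : 'M[R]_(p, q)) : dotm A C = dotm C A.
Proof. by do 2!apply: eq_bigr => ? _; rewrite mulrC. Qed.

Lemma dotm0l p q (A : 'M[R]_(p, q)) : dotm 0 A = 0.
Proof. by rewrite dotmE !linear0 mul0mx linear0. Qed.

Lemma dotm0r p q (A : 'M[R]_(p, q)) : dotm A 0 = 0.
Proof. by rewrite dotmC dotm0l. Qed.

Lemma dotv0l p (u : 'cV[R]_p) : dotv 0 u = 0.
Proof. by rewrite dotvE -dotmE dotm0l. Qed.

Lemma dotv0r p (u : 'cV[R]_p) : dotv u 0 = 0.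
Proof. by rewrite dotvC dotv0l. Qed.

Context (m n : nat) (B : 'M[R]_(n, m)) (b : 'cV[R]_n).

Lemma dotv_adj (x : 'cV[R]_m) (y : 'cV[R]_n) : dotv x (B^T *m y) = dotv (B *m x) y.
Proof. by rewrite !dotvE trmx_mul mulmxA. Qed.

(* The adjoint of the linear map defining the constraints of [LBB'_feasible]:
   its three components are the equations of [RLT1'_feasible]. *)
Lemma lagrangian_adj (x : 'cV[R]_m) (X : 'M[R]_m)
    (Y : 'M[R]_(n, m)) (z : 'cV[R]_m) (y : 'cV[R]_n) :
  dotv x (B^T *m y - (2 *: (Y^T *m b) + z))
    + dotm X (B^T *m Y + Y^T *m B + Diag z)
  = dotv (B *m x) y + dotm (B *m (X + X^T) - 2 *: (b *m x^T)) Y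
    + dotv (diagv X - x) z.
Proof.
have trYb : dotv x (Y^T *m b) = dotm (b *m x^T) Y.
  rewrite dotvE -mxtrace_tr !trmx_mul !trmxK mxtrace_mulC mulmxA.
  by rewrite dotmE trmx_mul trmxK.
have trBY : dotm X (B^T *m Y) = dotm (B *m X) Y.
  by rewrite !dotmE trmx_mul mulmxA.
have trYB : dotm X (Y^T *m B) = dotm (B *m X^T) Y.
  by rewrite -dotm_tr trmx_mul trmxK !dotmE !trmx_mul !trmxK mulmxA.
have diagXz : dotm X (Diag z) = dotv (diagv X) z.
  apply: eq_bigr => i _; rewrite (bigD1 i) //= !mxE eqxx mulr1n big1 ?addr0 //.
  by move=> j ji; rewrite !mxE eq_sym (negPf ji) mulr0n mulr0.
rewrite -scaleN1r -[_ - x]addrC -[_ - 2 *: _]addrC -scaleNr -[- x]scaleN1r.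
rewrite !(dotvDr, dotvZr, dotmDr, dotmDl, dotmZl, dotvDl) mulmxDr dotmDl.
rewrite trYb trBY trYB diagXz dotv_adj [dotv (-1 *: x) z]dotvC dotvZr.
by rewrite [dotv z x]dotvC; ring.
Qed.

(** The coefficients of [Y] and [z] in the Lagrangian are residuals of the RLT1' equations and
    vanish; only the term in [y] survives. *)
Lemma RLT1'_lagrangian (x : 'cV[R]_m) (X : 'M[R]_m)
    (Y : 'M[R]_(n, m)) (z : 'cV[R]_m) (y : 'cV[R]_n) :
  RLT1'_feasible B b x X ->
  dotv x (B^T *m y - (2 *: (Y^T *m b) + z))
    + dotm X (B^T *m Y + Y^T *m B + Diag z) = dotv b y.
Proof.
case=> Xsym [Bx BX xX _ _].
rewrite lagrangian_adj Xsym mulmxDr BX -xX Bx subrr dotv0l addr0.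
by rewrite scaler_nat mulr2n subrr dotm0l addr0.
Qed.

End Pairings.

(** * Duality over [Kbar], and between LBB' and RLT1' *)

Section Bounds.
Context (R : realType) (m n : nat) (B : 'M[R]_(n, m)) (b : 'cV[R]_n).

(** With [y] as the free variable, the dual feasible multipliers are exactly the points of [Kbar],
    so a point of [Kbar] provides the feasibility that strong duality requires. *)
Lemma min_Kbar_duality (c : 'cV[R]_m) :
  Kbar B b !=set0 ->
  (min_Kbar B b c
   <= ereal_sup [set (dotv b y)%:E | y in [set y | B^T *m y <=m c]])%E.
Proof.
pose a i (y : 'cV[R]_n) := (B^T *m y) i 0.
have lin_a i : scalar (a i).
  by move=> s y y'; rewrite /a mulmxDr -scalemxAr !mxE.
have lin_g : scalar (dotv b) by move=> s y y'; rewrite dotvDr dotvZr.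
have sumE (x : 'cV[R]_m) y : \sum_i x i 0 * a i y = dotv (B *m x) y.
  by rewrite -dotv_adj.
have dual_Kbar u : lp_dual_feasible a (dotv b) u -> Kbar B b (\col_i u i).
  move=> [u_ge0 gu]; split=> [i j|]; first by rewrite !mxE.
  apply/matrixP => i j; rewrite (ord1 j) -!dotv_delta gu -sumE.
  by apply: eq_bigr => l _; rewrite mxE.
case=> x [x_ge0 Bx].
apply: (le_trans _ (le_trans (lp_strong_duality (d := fun i => c i 0) lin_a lin_g _) _)).
- apply: le_ereal_inf_tmp => _ [u uP <-]; apply: ereal_inf_lbound.
  exists (\col_i u i); first exact: dual_Kbar.
  by congr EFin; rewrite dotvC; apply: eq_bigr => i _; rewrite mxE.
- left; exists (fun i => x i 0); split=> [i|y]; last by rewrite sumE Bx.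
  by have := x_ge0 i 0; rewrite mxE.
apply: ge_ereal_sup => _ [y yP <-]; apply: ereal_sup_ubound; exists y => //.
by move=> i j; rewrite (ord1 j); exact: yP.
Qed.

(** Strong duality with variable [(Y, z, y)]: the multipliers of the vector constraints form [x],
    those of the matrix constraints form [X]. *)
Lemma vRLT1'_le_vLBB' (Q : 'M[R]_m) :
  Q^T = Q ->
  (exists x X, RLT1'_feasible B b x X) \/
    (exists Y z y, LBB'_feasible B b Q Y z y) ->
  (vRLT1' B b Q <= vLBB' B b Q)%E.
Proof.
move=> Qsym feas.
pose V := ('M[R]_(n, m) * 'cV[R]_m * 'cV[R]_n)%type.
pose A1 (v : V) := B^T *m v.2 - (2 *: (v.1.1^T *m b) + v.1.2).
pose A2 (v : V) := B^T *m v.1.1 + v.1.1^T *m B + Diag v.1.2.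
pose a (o : 'I_m + 'I_m * 'I_m) v :=
  match o with inl i => A1 v i 0 | inr (i, j) => A2 v i j end.
pose d (o : 'I_m + 'I_m * 'I_m) :=
  match o with inl i => 0 | inr (i, j) => Q i j end.
have A1lin : linear A1.
  move=> s [[Y z] y] [[Y' z'] y']; rewrite /A1 /=.
  have -> : (s *: Y + Y')^T = s *: Y^T + Y'^T by exact: linearP.
  rewrite mulmxDr mulmxDl -scalemxAr -scalemxAl.
  by rewrite !scalerDr; apply/matrixP => i j; rewrite !mxE; ring.
have A2lin : linear A2.
  move=> s [[Y z] y] [[Y' z'] y']; rewrite /A2 /= /Diag.
  have -> : (s *: Y + Y')^T = s *: Y^T + Y'^T by exact: linearP.
  have -> : diag_mx (s *: z + z')^T = s *: diag_mx z^T + diag_mx z'^T.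
    by rewrite !linearP.
  rewrite mulmxDr mulmxDl -scalemxAr -scalemxAl.
  by rewrite !scalerDr; apply/matrixP => i j; rewrite !mxE; ring.
have lin_a o : scalar (a o).
  by case: o => [i|[i j]] s v w; rewrite /a (A1lin, A2lin) !mxE.
have lin_g : scalar (fun v : V => dotv b v.2).
  by move=> s v w; rewrite dotvDr dotvZr.
have sumE (u : 'I_m + 'I_m * 'I_m -> R) v :
    \sum_o u o * a o v = dotv (\col_i u (inl i)) (A1 v)
                         + dotm (\matrix_(i, j) u (inr (i, j))) (A2 v).
  rewrite big_sumType /=; congr (_ + _).
    by apply: eq_bigr => i _; rewrite mxE.
  rewrite /dotm pair_bigA; apply: eq_bigr => -[i j] _.
  by rewrite [in RHS]mxE.
have sumd (u : 'I_m + 'I_m * 'I_m -> R) :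
    \sum_o u o * d o = dotm Q (\matrix_(i, j) u (inr (i, j))).
  rewrite big_sumType /= big1 ?add0r => [|i _]; last by rewrite mulr0.
  rewrite dotmC /dotm pair_bigA; apply: eq_bigr => -[i j] _.
  by rewrite mxE.
apply: (le_trans _ (le_trans (lp_strong_duality (d := d) lin_a lin_g _) _)).
- apply: le_ereal_inf_tmp => _ [u [u_ge0 gu] <-]; apply: ereal_inf_lbound.
  pose x := \col_i u (inl i); pose X := \matrix_(i, j) u (inr (i, j)).
  have pairing Y z y : dotv b y = dotv (B *m x) y
      + dotm (B *m (X + X^T) - 2 *: (b *m x^T)) Y + dotv (diagv X - x) z.
    by rewrite (gu (Y, z, y)) sumE lagrangian_adj.
  (* Testing the identity on unit vectors for [y], [Y] and [z] in turn isolates the three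
     equations. *)
  have Bx : B *m x = b.
    apply/matrixP => i j; rewrite (ord1 j) -!dotv_delta (pairing 0 0).
    by rewrite dotm0r dotv0r !addr0.
  have BX : B *m (X + X^T) = 2 *: (b *m x^T).
    apply/eqP; rewrite -subr_eq0; apply/eqP/matrixP => i j.
    have := pairing (delta_mx i j) 0 0.
    by rewrite !dotv0r dotm_delta add0r addr0 => <-; rewrite mxE.
  have diagX : diagv X = x.
    apply/eqP; rewrite -subr_eq0; apply/eqP/matrixP => i j.
    have := pairing 0 (delta_mx i 0) 0.
    by rewrite !dotv0r dotm0r dotv_delta !add0r (ord1 j) => <-; rewrite mxE.
  (* The multiplier [X] need not be symmetric; its symmetric part is feasible and, [Q] being
     symmetric, has the same objective value. *)
  exists x, (2^-1 *: (X + X^T)); split; last first.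
    rewrite sumd -/X; congr EFin.
    rewrite [RHS]dotmC dotmZl dotmDl -[in dotm X^T _]Qsym dotm_tr dotmC.
    by field.
  split; first by rewrite linearZ linearD /= trmxK addrC.
  split=> //.
  - by rewrite -scalemxAr BX scalerA mulVf ?scale1r // pnatr_eq0.
  - by apply/matrixP => i j; rewrite (ord1 j) -diagX !mxE; field.
  - by move=> i j; rewrite !mxE.
  - by move=> i j; rewrite !mxE mulr_ge0 ?invr_ge0 ?addr_ge0.
- case: feas => [[x [X xX]]|[Y [z [y [yP YP]]]]].
    left; exists (fun o => match o with inl i => x i 0 | inr (i, j) => X i j end).
    have [_ [_ _ _ x_ge0 X_ge0]] := xX.
    split=> [[i|[i j]]|v].
    + by have := x_ge0 i 0; rewrite mxE.
    + by have := X_ge0 i j; rewrite mxE.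
    rewrite sumE /=.
    have -> : \col_i x i 0 = x by apply/matrixP => i j; rewrite mxE (ord1 j).
    have -> : \matrix_(i, j) X i j = X by apply/matrixP => i j; rewrite mxE.
    by rewrite RLT1'_lagrangian.
  right; exists (Y, z, y) => -[i|[i j]] /=; last exact: YP.
  by have := yP i 0; rewrite /A1 /= -subr_le0 [in (_ <= _ -> _)]mxE; rewrite !mxE.
apply: ge_ereal_sup => _ [[[Y z] y] vP <-]; apply: ereal_sup_ubound.
exists Y, z, y; split=> //; split=> i j; last exact: vP (inr (i, j)).
have := vP (inl i); rewrite /= /A1 /= (ord1 j) [_ i 0]mxE [X in _ + X]mxE subr_le0.
by [].
Qed.

(** Weak duality: in the Lagrangian expression for [b^T y], the first term is at most 0 because
    [x >= 0], the second at most [<Q, X>] because [X >= 0]. *)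
Lemma vLBB'_le_vRLT1' (Q : 'M[R]_m) : (vLBB' B b Q <= vRLT1' B b Q)%E.
Proof.
apply: ge_ereal_sup => _ [Y [z [y [[yP YP] ->]]]].
apply: le_ereal_inf_tmp => _ [x [X [xX ->]]].
have [_ [_ _ _ x_ge0 X_ge0]] := xX.
rewrite lee_fin dotmC -(RLT1'_lagrangian Y z y xX).
apply: le_trans (le_dotm X_ge0 YP); rewrite gerDr -scaleN1r dotvDr dotvZr.
by have := le_dotv x_ge0 yP; lra.
Qed.

End Bounds.

(** * Consequences of the redundancy of [x <= e] *)

Section RedundantUpperBound.
Context (R : realType) (m n : nat) (B : 'M[R]_(n, m)) (b : 'cV[R]_n).
Hypotheses (Kbar0 : Kbar B b !=set0) (redundant : upper_bound_redundant B b).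

(* For [x] in [Kbar] and [s >= 0], the point [(x + s v) / (1 + s t)] is in
   [Kbar], hence at most [e]; let [s] go to infinity. *)
Lemma Kbar_cone_le (t : R) (v : 'cV[R]_m) :
  0 <= t -> 0 <=m v -> B *m v = t *: b -> forall i, v i 0 <= t.
Proof.
move=> t_ge0 v_ge0 Bv i; rewrite leNgt; apply/negP; rewrite -subr_gt0 => vt.
have [x [x_ge0 Bx]] := Kbar0.
have xi_ge0 : 0 <= x i 0 by have := x_ge0 i 0; rewrite mxE.
(* A finite [s] suffices: [s (v_i - t) = 2] contradicts [x_i + s v_i <= 1 + s t]. *)
pose s := 2 / (v i 0 - t).
have s_ge0 : 0 <= s by rewrite divr_ge0 ?ltW.
have st : 0 < 1 + s * t by rewrite ltr_pwDl // mulr_ge0.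
have /redundant : Kbar B b ((1 + s * t)^-1 *: (x + s *: v)).
  split=> [k l|].
    rewrite (ord1 l) !mxE mulr_ge0 ?invr_ge0 ?(ltW st) // addr_ge0 //.
      by have := x_ge0 k 0; rewrite mxE.
    by rewrite mulr_ge0 //; have := v_ge0 k 0; rewrite mxE.
  rewrite -scalemxAr mulmxDr -scalemxAr Bx Bv scalerA.
  by rewrite -{1}[b]scale1r -scalerDl scalerA mulVf ?scale1r // gt_eqF.
move=> /(_ i 0); rewrite !mxE ler_pdivrMl // mulr1.
have : s * (v i 0 - t) = 2 by rewrite divfK // gt_eqF.
by lra.
Qed.

Lemma RLT1'_RLT1 x X : RLT1'_feasible B b x X -> RLT1_feasible B b x X.
Proof.
move=> xX; split=> //; case: xX => Xsym [Bx BX xX x_ge0 X_ge0].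
have xi_ge0 i : 0 <= x i 0 by have := x_ge0 i 0; rewrite mxE.
have Xij_ge0 i j : 0 <= X i j by have := X_ge0 i j; rewrite mxE.
have Xij i j : X i j = X j i by rewrite -[in LHS]Xsym mxE.
have Bcol j : B *m col j X = x j 0 *: b.
  rewrite colE mulmxA -colE BX; apply/matrixP => i l.
  by rewrite (ord1 l) !mxE big_ord1 !mxE mulrC.
have X_le i j : X i j <= x j 0.
  have := Kbar_cone_le (xi_ge0 j) _ (Bcol j) i; rewrite mxE; apply.
  by move=> k l; rewrite !mxE.
have x_le i : x i 0 <= 1.
  by apply: (Kbar_cone_le (t := 1)) => //; rewrite Bx scale1r.
split=> i j; rewrite ?(ord1 j) !mxE ?big_ord1 ?mxE ?subr_ge0 //; last first.
  by rewrite mulr1 Xij.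
(* Entry [i] of the cone bound for [x - X_j] is [x_i - X_ij <= 1 - x_j], the remaining inequality of
   RLT1. *)
have := Kbar_cone_le (t := 1 - x j 0) (v := x - col j X) _ _ _ i.
rewrite !mxE subr_ge0 mulmxBr Bx Bcol scalerBl scale1r => /(_ (x_le j)).
rewrite mulr1 mul1r; set P := (0 <=m _); suff XP : P.
  by move=> /(_ XP erefl); lra.
by move=> k l; rewrite (ord1 l) !mxE subr_ge0 Xij.
Qed.

Lemma vRLT1'_vRLT1 Q : vRLT1' B b Q = vRLT1 B b Q.
Proof.
congr ereal_inf; apply/seteqP; split=> _ [x [X [xX ->]]]; exists x, X.
  by split=> //; exact: RLT1'_RLT1.
by case: xX.
Qed.

(* By duality, boundedness of [Kbar] gives [w] with [B^T w <= -e]; the multiples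
   [Y = s w e^T] make [B^T Y] as negative as needed. *)
Lemma LBB'_feasible_exists Q : exists Y z y, LBB'_feasible B b Q Y z y.
Proof.
have [w Bw] : exists w, B^T *m w <=m - onev R m.
  apply: contrapT => noW.
  have := min_Kbar_duality (- onev R m) Kbar0.
  (* Without such a [w] the dual supremum is over the empty set, so the minimum of [-e^T x] would be
     [-oo]; redundancy bounds it below by [-m]. *)
  suff -> : [set y | B^T *m y <=m - onev R m] = set0.
    rewrite image_set0 ereal_sup0 leeNy_eq => /eqP infNy.
    have : ((- m%:R)%:E <= min_Kbar B b (- onev R m))%E.
      apply: le_ereal_inf_tmp => _ [x xK <-]; rewrite lee_fin.
      have -> : - m%:R = \sum_(i < m) (-1 : R).
        by rewrite sumrN sumr_const card_ord.
      apply: ler_sum => i _; rewrite !mxE mulN1r lerN2.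
      by have := redundant xK i 0; rewrite mxE.
    by rewrite infNy leeNy_eq.
  by apply/seteqP; split=> // y yP; apply: noW; exists y.
have Bwi i : (B^T *m w) i 0 <= -1 by have := Bw i 0; rewrite !mxE.
pose s := \sum_i \sum_j `|Q i j|.
have s_ge0 : 0 <= s by apply: sumr_ge0 => i _; exact: sumr_ge0.
have Qs i j : - s <= Q i j.
  rewrite lerNl (le_trans (ler_norm _)) // normrN /s (bigD1 i) //= (bigD1 j) //=.
  by rewrite -addrA lerDl addr_ge0 // !sumr_ge0 // => k _; exact: sumr_ge0.
pose Y := s *: (w *m (onev R m)^T).
pose c := 2 *: (Y^T *m b) + 0 : 'cV[R]_m.
pose t := \sum_i `|c i 0|.
have t_ge0 : 0 <= t by exact: sumr_ge0.
(* The entries of [B^T Y] are at most [-s], so those of its sum with its transpose are at most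
   [-2s <= -s <= Q_ij]. Likewise [-t] is a lower bound for the entries of [c]. *)
exists Y, 0, (t *: w); split=> i j.
  rewrite (ord1 j) -/c -scalemxAr [leLHS]mxE.
  apply: (@le_trans _ _ (- t)).
    by rewrite -mulrN1 ler_wpM2l.
  rewrite lerNl (le_trans (ler_norm _)) // normrN /t (bigD1 i) //=.
  by rewrite lerDl sumr_ge0.
have BY k l : (B^T *m Y) k l = s * (B^T *m w) k 0.
  by rewrite /Y -scalemxAr mulmxA mxE [X in _ * X]mxE big_ord1 !mxE mulr1.
have -> : Y^T *m B = (B^T *m Y)^T by rewrite trmx_mul trmxK.
have -> : Diag 0 = 0 :> 'M[R]_m by rewrite /Diag !linear0.
rewrite addr0 [leLHS]mxE [X in _ + X]mxE !BY.
apply: le_trans (Qs i j); rewrite -mulrDr -mulrN1 ler_wpM2l //.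
by have := Bwi i; have := Bwi j; lra.
Qed.

End RedundantUpperBound.

(** * The Gilmore-Lawler scheme *)

Section GilmoreLawler.
Context (R : realType) (m n : nat) (B : 'M[R]_(n, m)) (b : 'cV[R]_n).

Lemma col_GL_M Y z k :
  col k (GL_M B Y z) = B^T *m col k Y + z k 0 *: col k 1%:M.
Proof.
rewrite [col k Y]colE mulmxA -colE; apply/matrixP => i j.
rewrite !mxE mulr_natr; congr (_ + _).
by have [->|] := eqVneq i k; rewrite // !mulr0n.
Qed.

Lemma GL_M_le M Y z : GL_optimal B b M Y z -> GL_M B Y z <=m M.
Proof.
move=> opt i k; have [/(_ i 0)] := opt k.
by rewrite -col_GL_M !mxE.
Qed.

Lemma GL_c_val (Y : 'M[R]_(n, m)) z k : GL_c b Y z k 0 = dotv b (col k Y) + z k 0.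
Proof.
by rewrite !mxE; congr (_ + _); apply: eq_bigr => i _; rewrite !mxE mulrC.
Qed.

Lemma GL_feasible0 M k : 0 <=m M -> GL_col_feasible B (col k M) k 0 0.
Proof.
move=> M_ge0 i j; rewrite mulmx0 scale0r addr0.
by have := M_ge0 i k; rewrite !mxE.
Qed.

(** For [M >= 0] the zero solution is feasible in every column program, so each optimal value is
    nonnegative. *)
Lemma GL_c_ge0 M Y z : 0 <=m M -> GL_optimal B b M Y z -> 0 <=m GL_c b Y z.
Proof.
move=> M_ge0 opt k j; rewrite (ord1 j) GL_c_val mxE.
have [_ /(_ 0 0 (GL_feasible0 k M_ge0))] := opt k.
by rewrite dotv0r addr0.
Qed.

(* The residual has the trivial solution, which is optimal: any improvement
   could be added to [(Y, z)]. *)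
Lemma GL_optimal_residual M Y z :
  GL_optimal B b M Y z -> GL_optimal B b (M - GL_M B Y z) 0 0.
Proof.
move=> opt k; rewrite col0 mxE; split.
  apply: GL_feasible0 => i j; rewrite !mxE subr_ge0.
  by have := GL_M_le opt i j; rewrite !mxE.
move=> y' z' y'P; rewrite dotv0r addr0.
have [_ /(_ (y' + col k Y) (z' + z k 0))] := opt k.
rewrite dotvDr => optk; suff /optk : 
  GL_col_feasible B (col k M) k (y' + col k Y) (z' + z k 0) by lra.
move=> i j; have := y'P i j.
rewrite mulmxDr scalerDl addrACA -col_GL_M; set P := B^T *m y' + _.
by rewrite (ord1 j) !mxE lerBrDr.
Qed.

Lemma le_min_Kbar c c' : c <=m c' -> (min_Kbar B b c <= min_Kbar B b c')%E.
Proof.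
move=> cc'; apply: le_ereal_inf_tmp => _ [x xK <-].
apply: ge_ereal_inf; exists (dotv c x)%:E; first by exists x.
by rewrite lee_fin dotvC [leRHS]dotvC le_dotv //; case: xK.
Qed.

Lemma vGL_le_vGGL Q Y0 z0 :
  GL_optimal B b Q Y0 z0 -> (vGL B b Y0 z0 <= vGGL B b Q)%E.
Proof.
move=> opt; apply: ereal_sup_ubound.
pose Y (i : nat) := if i is 0%N then Y0 else 0.
pose z (i : nat) : 'cV[R]_m := if i is 0%N then z0 else 0.
(* If [c_0 = 0] the run stops at step 0. Otherwise, with [S = 0], the zero solution is optimal for
   the residual and the run stops at step 1. *)
have [c0|c0] := eqVneq (GL_c b Y0 z0) 0.
  exists Y, z, (fun=> 0), 0%N; split; first by split=> // -[].
  by rewrite /GGL_output big_ord1.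
have c1 : GL_c b (Y 1%N) (z 1%N) = 0 by rewrite /GL_c linear0 mul0mx addr0.
exists Y, z, (fun=> 0), 1%N; split; last first.
  by rewrite /GGL_output big_ord_recr big_ord1 /= c1 addr0.
split=> //.
- case=> [_|[_|//]]; first exact: opt.
  by rewrite /= addr0; exact: GL_optimal_residual.
- by move=> i _; rewrite linear0 oppr0.
- by case=> // _; exact/eqP.
Qed.

(** This concerns each single run rather than the best one: nonnegative residuals make every later
    increment of [c] nonnegative. *)
Lemma vGL_le_GGL_output Q Y z S N :
  GGL_run B b Q Y z S N ->
  (forall i, (0 < i <= N)%N -> 0 <=m GGL_Q B Q Y z S i) ->
  (vGL B b (Y 0%N) (z 0%N) <= GGL_output B b Y z N)%E.
Proof.
move=> [opt _ _ _] Q_ge0; apply: le_min_Kbar => i j.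
rewrite big_ord_recl [leRHS]mxE lerDl summxE sumr_ge0 // => k _.
have := GL_c_ge0 (Q_ge0 (lift ord0 k) _) (opt _ _) i j; rewrite mxE; apply.
  by rewrite lift0 /= ltn_ord.
by rewrite -ltnS.
Qed.

(* Telescoping; the skew-symmetric terms vanish in [Z + Z^T]. *)
Lemma GGL_Q_symmetrized Q Y z S N :
  Q^T = Q -> (forall i, (0 < i <= N)%N -> (S i)^T = - S i) ->
  GGL_Q B Q Y z S N + (GGL_Q B Q Y z S N)^T =
  2 *: Q - \sum_(i < N) (GL_M B (Y i) (z i) + (GL_M B (Y i) (z i))^T).
Proof.
move=> Qsym; elim: N => [|N IHN] Sskew.
  by rewrite big_ord0 subr0 /= Qsym scaler_nat.
rewrite big_ord_recr opprD addrA -IHN => [|i /andP[i0 iN]]; last first.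
  by rewrite Sskew // i0 (leqW iN).
rewrite /= !(linearD, linearN) /= (Sskew N.+1) ?leqnn //.
by apply/matrixP => i j; rewrite !mxE; ring.
Qed.

Lemma vGGL_le_vLBB' Q :
  Kbar B b !=set0 -> Q^T = Q -> (vGGL B b Q <= vLBB' B b Q)%E.
Proof.
move=> Kbar0 Qsym; apply: ge_ereal_sup => _ [Y [z [S [N [[opt Sskew _ _] ->]]]]].
pose W := \sum_(i < N.+1) Y i; pose w := \sum_(i < N.+1) z i.
have cE : \sum_(i < N.+1) GL_c b (Y i) (z i) = W^T *m b + w.
  by rewrite big_split /= -mulmx_suml -linear_sum.
have ME : \sum_(i < N.+1) GL_M B (Y i) (z i) = B^T *m W + Diag w.
  by rewrite big_split /= -mulmx_sumr /Diag !linear_sum.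
apply: le_trans (min_Kbar_duality _ Kbar0) _.
apply: ge_ereal_sup => _ [y yP <-]; apply: ereal_sup_ubound.
(* Symmetrizing doubles the diagonal part, while [B^T W] is paired with its transpose; after
   division by 2, [W] is halved and [w] is not. *)
exists (2^-1 *: W), w, y; split=> //.
have halfW : (2^-1 *: W)^T = 2^-1 *: W^T by rewrite linearZ.
split.
  by rewrite halfW -scalemxAl scalerA divff ?pnatr_eq0 // scale1r -cE.
(* The last residual dominates the last [GL_M]. Adding transposes and telescoping gives
   [B^T W + W^T B + 2 Diag w <= 2 Q]. *)
have QN := GGL_Q_symmetrized Y z Qsym Sskew.
have MN := GL_M_le (opt N (leqnn N)).
have symM : \sum_(i < N.+1) (GL_M B (Y i) (z i) + (GL_M B (Y i) (z i))^T)
    = B^T *m W + W^T *m B + 2 *: Diag w.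
  rewrite big_split /= -linear_sum /= ME linearD /= trmx_mul trmxK tr_diag_mx.
  by apply/matrixP => i j; rewrite !mxE; ring.
move: symM; rewrite big_ord_recr /= => symM i j.
have /matrixP/(_ i j) := symM; have /matrixP/(_ i j) := QN.
rewrite halfW -scalemxAr -scalemxAl.
have := MN i j; have := MN j i. by rewrite !mxE; lra.
Qed.

End GilmoreLawler.

(** * Comparison with the bound from linearizable matrices, and the full chain *)

Lemma vLBB'_le_vLBBstar (R : realType) (m n : nat) (Q : 'M[R]_m)
    (B : 'M[R]_(n, m)) (b : 'cV[R]_n)
    (k : nat) (Ms : 'I_k -> 'M[R]_m) (cs : 'I_k -> 'cV[R]_m) :
  (vLBB' B b Q <= vLBBstar B b Q Ms cs)%E.
Proof.
apply: ereal_sup_le => _ [Y [z [y [[yP YP] ->]]]]; exists Y, z, 0, y; split=> //.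
split; last by rewrite mulmx0 addr0.
by rewrite big1 ?addr0 // => i _; rewrite mxE scale0r.
Qed.

Theorem proposition6p4 (R : realType) (m n : nat) (Q : 'M[R]_m)
    (B : 'M[R]_(n, m)) (b : 'cV[R]_n)
    (k : nat) (Ms : 'I_k -> 'M[R]_m) (cs : 'I_k -> 'cV[R]_m) :
  Q^T = Q ->
  spans_linearizable B b Ms ->
  (forall i, linearization_vector B b (Ms i) (cs i)) ->
  (Kbar B b !=set0 -> upper_bound_redundant B b ->
     (forall Y0 z0, GL_optimal B b Q Y0 z0 ->
        (vGL B b Y0 z0 <= vGGL B b Q)%E) /\
     (forall Y z S N, GGL_run B b Q Y z S N ->
        (forall i, (0 < i <= N)%N -> 0 <=m GGL_Q B Q Y z S i) ->
        (vGL B b (Y 0%N) (z 0%N) <= GGL_output B b Y z N)%E) /\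
     [/\ (vGGL B b Q <= vLBB' B b Q)%E,
         vLBB' B b Q = vRLT1' B b Q,
         vRLT1' B b Q = vRLT1 B b Q
       & (vRLT1 B b Q <= vLBBstar B b Q Ms cs)%E]) /\
  (~ upper_bound_redundant B b ->
     ((exists x X, RLT1'_feasible B b x X) \/
        (exists Y z y, LBB'_feasible B b Q Y z y) ->
        (vRLT1' B b Q <= vLBB' B b Q)%E) /\
     (vLBB' B b Q <= vLBBstar B b Q Ms cs)%E).
Proof.
move=> Qsym _ _; split=> [Kbar0 redundant|_]; last first.
  by split; [exact: vRLT1'_le_vLBB'|exact: vLBB'_le_vLBBstar].
(* Redundancy supplies a feasible point of LBB', as strong duality requires. *)
have RLT1'_LBB' : (vRLT1' B b Q <= vLBB' B b Q)%E.
  by apply: vRLT1'_le_vLBB' => //; right; exact: LBB'_feasible_exists.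
split; first exact: vGL_le_vGGL.
split; first exact: vGL_le_GGL_output.
split.
- exact: vGGL_le_vLBB'.
- by apply/eqP; rewrite eq_le vLBB'_le_vRLT1' RLT1'_LBB'.
- exact: vRLT1'_vRLT1.
rewrite -vRLT1'_vRLT1 //; apply: le_trans RLT1'_LBB' _.
exact: vLBB'_le_vLBBstar.
Qed.
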